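(* Let $Q=[u_1,\dots,u_{2n}]\subset\mathbb{S}^2$ with $2n\ge 6$ be a spherical polygon which is symmetric, i.e. $u_{i+n}=-u_i$ for all $i$. Let $D^+$ be the number of self-intersections of $Q$ and $I$ the number of inflections of $Q$. Then $2D^++I\ge 6$.
   Context: A spherical polygon $Q=[u_1,\dots,u_m]$ is a cyclic sequence of points of $\mathbb{S}^2$ (indices mod $m$) whose edges are the minimal great-circle arcs from $u_i$ to $u_{i+1}$. Standing assumption: no three vertices of $Q$ lie on a common great circle. A self-intersection is a pair of non-adjacent edges that intersect. With $[a,b,c]$ the determinant of $a,b,c\in\mathbb{R}^3$, the pair $\{u_i,u_{i+1}\}$ is an inflection if $[u_{i-1},u_i,u_{i+1}]$ and $[u_i,u_{i+1},u_{i+2}]$ have opposite signs.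
   Formalization: Since u_i, −u_i and u_j always lie on a common great circle, the standing assumption cannot hold literally for a symmetric polygon; it is read as: no three vertices u_i, u_j, u_k with i, j, k pairwise distinct mod n lie on a common great circle. *)

(* Defs.v *)
From HB Require Import structures.
From mathcomp Require Import all_boot all_order all_algebra.
From mathcomp Require Import boolp reals.

Set Implicit Arguments.
Unset Strict Implicit.
Unset Printing Implicit Defensive.

Import Order.TTheory GRing.Theory Num.Theory.
Local Open Scope ring_scope.

Definition det3 (R : comRingType) (a b c : 'rV[R]_3) : R :=
  \det (\matrix_(i < 3, j < 3) (nth 0 [:: a; b; c] i) 0 j).

Definition on_sphere (R : realType) (x : 'rV[R]_3) : Prop :=
  \sum_(j < 3) x 0 j ^+ 2 = 1.

Definition vtx (R : realType) (u : nat -> 'rV[R]_3) (m i : nat) : 'rV[R]_3 :=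
  u (i %% m)%N.

(* x lies on the minimal great-circle arc from a to b (a, b unit vectors,
   not antipodal): the arc is the intersection of S^2 with the cone
   {s a + t b | s, t >= 0}. *)
Definition on_arc (R : realType) (a b x : 'rV[R]_3) : Prop :=
  on_sphere x /\ exists s t : R, 0 <= s /\ 0 <= t /\ x = s *: a + t *: b.

Definition edges_meet (R : realType) (u : nat -> 'rV[R]_3) (m i j : nat) : Prop :=
  exists x, on_arc (vtx u m i) (vtx u m i.+1) x /\ on_arc (vtx u m j) (vtx u m j.+1) x.

Definition adjacent (m i j : nat) : bool :=
  ((i.+1 %% m == j %% m) || (j.+1 %% m == i %% m))%N.

Definition num_self_intersections (R : realType) (u : nat -> 'rV[R]_3) (m : nat) : nat :=
  #|[set p : 'I_m * 'I_m |
      [&& (p.1 < p.2)%N, ~~ adjacent m p.1 p.2 & `[< edges_meet u m p.1 p.2 >]]]|.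

Definition num_inflections (R : realType) (u : nat -> 'rV[R]_3) (m : nat) : nat :=
  #|[set i : 'I_m |
      det3 (vtx u m (i + m).-1) (vtx u m i) (vtx u m i.+1)
      * det3 (vtx u m i) (vtx u m i.+1) (vtx u m i.+2) < 0]|.

(* Main.v *)
(** The turns [u_{i-1}, u_i, u_{i+1}] change sign under i |-> i + n, so inflections
    come in antipodal pairs and there is at least one pair; crossings also come in
    antipodal pairs, since an edge never meets its antipode.  It remains to show that
    a simple Q has three pairs of inflections.  Otherwise the turns are all positive
    along a chain p_0, ..., p_n = - p_0.  Follow this chain, keeping a convex window
    p_j, ..., p_m whose cone contains p_0.  If p_{m+1} lies outside the window's
    polygon, a suffix of the window together with p_{m+1} is a convex window with a
    larger cone.  If the chain enters the polygon, it spirals inwards and can no longer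
    leave it without a crossing.  In both cases p_0 and p_n end up in a common pointed
    cone, which is absurd as p_n = - p_0. *)

Require Import Defs.
From HB Require Import structures.
From mathcomp Require Import all_boot all_order all_algebra.
From mathcomp Require Import boolp reals.
From mathcomp Require Import ring lra zify.

Set Implicit Arguments.
Unset Strict Implicit.
Unset Printing Implicit Defensive.

Import Order.TTheory GRing.Theory Num.Theory.
Local Open Scope ring_scope.

(** * Determinants and linear forms in dimension three *)

Definition dotv (R : comNzRingType) (w x : 'rV[R]_3) : R :=
  \sum_(j < 3) w 0 j * x 0 j.

Lemma sum_ord3 (V : nmodType) (F : 'I_3 -> V) :
  \sum_(j < 3) F j = F 0 + F 1 + F 2%:R.
Proof.
rewrite !big_ord_recl big_ord0 addr0 addrA.
by congr (F _ + F _ + F _); apply/val_inj.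
Qed.

Lemma det3E (R : comNzRingType) (a b c : 'rV[R]_3) :
  det3 a b c = a 0 0 * (b 0 1 * c 0 2%:R - b 0 2%:R * c 0 1)
    - a 0 1 * (b 0 0 * c 0 2%:R - b 0 2%:R * c 0 0)
    + a 0 2%:R * (b 0 0 * c 0 1 - b 0 1 * c 0 0).
Proof.
have rowE (x : 'rV[R]_3) : x = \row_j x 0 (inord j).
  by apply/rowP => j; rewrite mxE inord_val.
rewrite (rowE a) (rowE b) (rowE c) /det3 (expand_det_row _ 0) sum_ord3 /cofactor.
rewrite !(expand_det_row _ ord0) !big_ord_recl !big_ord0 /cofactor !det_mx11.
rewrite !mxE /bump /= /bump /= !addn0 !modn_small //; ring.
Qed.

Lemma det3C (R : comNzRingType) (a b c : 'rV[R]_3) : det3 a b c = det3 b c a.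
Proof. by rewrite !det3E; ring. Qed.

(** The vector [w] is the cross product of [a] and [b]. This lets oriented edges serve as the linear
    forms that test cones and half-spaces. *)
Lemma det3_dotv (R : comNzRingType) (a b : 'rV[R]_3) :
  exists w, forall x, det3 a b x = dotv w x.
Proof.
exists (\row_j det3 a b (delta_mx 0 j)) => x.
by rewrite /dotv sum_ord3 !mxE !det3E !mxE /=; ring.
Qed.

Lemma dotvDZ (R : comNzRingType) (w x y : 'rV[R]_3) s t :
  dotv w (s *: x + t *: y) = s * dotv w x + t * dotv w y.
Proof. by rewrite /dotv !sum_ord3 !mxE; ring. Qed.

Lemma dotvDl (R : comNzRingType) (v w x : 'rV[R]_3) :
  dotv (v + w) x = dotv v x + dotv w x.
Proof. by rewrite /dotv !sum_ord3 !mxE; ring. Qed.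

Lemma dotvN (R : comNzRingType) (w x : 'rV[R]_3) : dotv w (- x) = - dotv w x.
Proof. by rewrite /dotv !sum_ord3 !mxE; ring. Qed.

Lemma det3DZ (R : comNzRingType) (x y b c : 'rV[R]_3) s t :
  det3 (s *: x + t *: y) b c = s * det3 x b c + t * det3 y b c.
Proof. by rewrite !det3E !mxE; ring. Qed.

(** Cramer's rule for four vectors. For a convex quadrilateral all coefficients are positive, and
    both sides represent the intersection of the diagonals [a c] and [b d]. *)
Lemma det3_relation (R : comNzRingType) (a b c d : 'rV[R]_3) :
  det3 b c d *: a + det3 a b d *: c = det3 a c d *: b + det3 a b c *: d.
Proof.
apply/rowP => j; rewrite !mxE !det3E.
have : j \in [:: 0; 1; 2%:R] by case: j => [] [|[|[]]].
by rewrite !inE => /or3P[] /eqP ->; ring.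
Qed.

Lemma det3_rep12 (R : comNzRingType) (a b : 'rV[R]_3) : det3 a a b = 0.
Proof. by rewrite det3E; ring. Qed.

Lemma det3_rep23 (R : comNzRingType) (a b : 'rV[R]_3) : det3 a b b = 0.
Proof. by rewrite det3C det3_rep12. Qed.

Lemma det3_rep13 (R : comNzRingType) (a b : 'rV[R]_3) : det3 a b a = 0.
Proof. by rewrite -det3C det3_rep12. Qed.

Lemma det3N (R : comNzRingType) (a b c : 'rV[R]_3) : det3 a b (- c) = - det3 a b c.
Proof. by rewrite !det3E !mxE; ring. Qed.

Lemma det3_swap (R : comNzRingType) (a b c : 'rV[R]_3) : det3 a b c = - det3 b a c.
Proof. by rewrite !det3E; ring. Qed.

Lemma det3Z (R : comNzRingType) (a b c : 'rV[R]_3) s :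
  det3 (s *: a) b c = s * det3 a b c.
Proof. by rewrite !det3E !mxE; ring. Qed.

Lemma dotvZ (R : comNzRingType) (w x : 'rV[R]_3) s : dotv w (s *: x) = s * dotv w x.
Proof. by rewrite /dotv !sum_ord3 !mxE; ring. Qed.

Lemma dotv_relation (R : comNzRingType) (w a b c d : 'rV[R]_3) :
  det3 b c d * dotv w a + det3 a b d * dotv w c
  = det3 a c d * dotv w b + det3 a b c * dotv w d.
Proof. by rewrite -!dotvDZ det3_relation. Qed.

(** Applying [det3 _ x y] to [det3_relation] gives a Grassmann-Plücker relation. Below, one of [a],
    [b], [c], [d] equals [x] or [y], which kills one term and lets signs propagate. *)
Lemma det3_plucker (R : comNzRingType) (a b c d x y : 'rV[R]_3) :
  det3 b c d * det3 a x y + det3 a b d * det3 c x y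
  = det3 a c d * det3 b x y + det3 a b c * det3 d x y.
Proof. by rewrite -!det3DZ det3_relation. Qed.

(** * Chains that spiral inwards *)

(* The exclusion of a = 0, c = n accounts for p_n = - p_0. *)
Definition generic_chain (R : realFieldType) (n : nat) (p : nat -> 'rV[R]_3) :=
  forall a b c : nat, (a < b)%N -> (b < c)%N -> (c <= n)%N ->
    ~~ ((a == 0) && (c == n))%N -> det3 (p a) (p b) (p c) != 0.

(* The first three sign conditions put p_j on the left of the edge p_i p_{i+1} and let
   the ray from p_j through p_{j+1} meet it; the conclusion then says that p_{j+1} comes
   before the meeting point. *)
Definition simple_chain (R : realFieldType) (n : nat) (p : nat -> 'rV[R]_3) :=
  forall i j : nat, (i.+1 < j)%N -> (j < n)%N ->
    det3 (p i) (p j) (p j.+1) < 0 -> 0 < det3 (p i.+1) (p j) (p j.+1) ->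
    0 < det3 (p i) (p i.+1) (p j) -> 0 <= det3 (p i) (p i.+1) (p j.+1).

(** All triples are required: consecutive left turns alone would allow a spiral. *)
Definition convex_window (R : realFieldType) (p : nat -> 'rV[R]_3) (j m : nat) :=
  forall a b c : nat, (j <= a)%N -> (a < b)%N -> (b < c)%N -> (c <= m)%N ->
    0 < det3 (p a) (p b) (p c).

(* The chain spirals inwards: (x, p_{i+1}, ..., p_m) is a convex polygon with x on the
   earlier edge p_i p_{i+1}; on entry x = p_i, and later x is the point at which the ray
   from p_{m-1} through p_m hits that edge.
   The form w > 0 witnesses that the trap stays inside a fixed open half-space. *)
Definition trapped (R : realFieldType) (p : nat -> 'rV[R]_3) (w : 'rV[R]_3)
    (i m : nat) (x : 'rV[R]_3) :=
  [/\ (i.+1 < m)%N,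
      exists s t, [/\ 0 <= s, 0 <= t & x = s *: p i + t *: p i.+1],
      convex_window p i.+1 m,
      forall a b : nat, (i < a)%N -> (a < b)%N -> (b <= m)%N ->
        0 <= det3 x (p a) (p b)
    & forall a : nat, (i <= a)%N -> (a <= m)%N -> 0 < dotv w (p a)].

(** The ray from [p m] through [p m.+1] leaves the trap through an edge of the chain, at [y].
    Simplicity stops [p m.+1] before [y], so [y] and [p k.+1], ..., [p m.+1] form a new trap. The
    last clause, at [z = p m.+2], restores the sign hypothesis for the next step. *)
Lemma trapped_step (R : realFieldType) (n : nat) (p : nat -> 'rV[R]_3) w i m x :
  p n = - p 0%N -> generic_chain n p -> simple_chain n p -> (m < n)%N ->
  trapped p w i m x -> 0 < det3 (p m.-1) (p m) (p m.+1) ->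
  det3 x (p m) (p m.+1) < 0 ->
  exists k y, trapped p w k m.+1 y /\
    forall z, 0 < det3 (p m) (p m.+1) z -> det3 y (p m.+1) z < 0.
Proof.
move=> pn gen simp mn [im [s [t [s0 t0 xE]]] conv xconv wpos] turn xneg.
pose F a := det3 (p a) (p m) (p m.+1).
have xF : det3 x (p m) (p m.+1) = s * F i + t * F i.+1 by rewrite xE det3DZ.
(* The last vertex to the right of the line from [p m] to [p m.+1] starts the edge that the ray
   crosses. One exists because [x], a nonnegative combination of [p i] and [p i.+1], lies to the
   right. *)
pose P a := [&& (i <= a)%N, (a <= m)%N & F a < 0].
have exP : exists a, P a.
  have [Fi|Fi] := ltP (F i) 0; first by exists i; rewrite /P Fi; lia.
  have [Fi1|Fi1] := ltP (F i.+1) 0; first by exists i.+1; rewrite /P Fi1; lia.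
  by move: xneg; rewrite xF ltNge addr_ge0 // mulr_ge0.
have ubP a : P a -> (a <= m)%N by case/and3P.
case: (ex_maxnP exP ubP) => k /and3P[ik km Fk] kmax.
have Fm : F m = 0 by rewrite /F det3_rep12.
have kltm : (k.+1 < m)%N.
  rewrite ltn_neqAle ltn_neqAle km andbT; apply/andP; split.
    by apply/eqP => km1; move: turn;
       rewrite -[in p m.-1]km1 -/(F k) => /(lt_trans Fk); rewrite ltxx.
  by apply/eqP => kE; rewrite kE Fm ltxx in Fk.
have Fpos a : (k < a)%N -> (a < m)%N -> 0 < F a.
  move=> ka am; rewrite lt0r gen ?leqnn //=; last by lia.
  rewrite leNgt; apply/negP => Fa.
  by have := kmax a; rewrite /P Fa; lia.
have nk0 : ~~ ((k == 0) && (m.+1 == n))%N.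
  apply/negP => /andP[/eqP k0 /eqP mE]; move: Fk.
  by rewrite /F k0 mE pn det3N det3_rep13 oppr0 ltxx.
pose A := det3 (p k) (p k.+1) (p m); pose B := det3 (p k) (p k.+1) (p m.+1).
(* Up to scaling, y is the point where the ray from p_m through p_{m+1} hits the edge
   p_k p_{k+1}; simplicity places p_{m+1} between p_m and y. *)
pose y := F k.+1 *: p k + (- F k) *: p k.+1.
have Fk1 : 0 < F k.+1 by apply: Fpos.
have yconv a b : (k < a)%N -> (a < b)%N -> (b <= m)%N -> 0 <= det3 y (p a) (p b).
  move=> ka ab bm; have k1ab : 0 <= det3 (p k.+1) (p a) (p b).
    have [ka1|ak] := ltnP k.+1 a; first by apply/ltW/conv => //; lia.
    have -> : a = k.+1 by lia.
    by rewrite det3_rep12.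
  have [ik'|ki] := ltnP i k.
    rewrite det3DZ addr_ge0 // mulr_ge0 // ?ltW // ?oppr_gt0 //.
    by apply: conv => //; lia.
  have kE : k = i by lia.
  have s_gt0 : 0 < s.
    rewrite lt0r s0 andbT; apply/eqP => sE; move: xneg.
    by rewrite xF sE mul0r add0r ltNge mulr_ge0 // -kE ltW.
  (* For [k = i] the new point [y] lies between [x] and [p i.+1], so it inherits the convexity of
     both. *)
  rewrite -(pmulr_rge0 _ s_gt0).
  have -> : s * det3 y (p a) (p b) = F i.+1 * det3 x (p a) (p b)
      - det3 x (p m) (p m.+1) * det3 (p i.+1) (p a) (p b).
    by rewrite xF xE !det3DZ kE; ring.
  rewrite addr_ge0 // ?mulr_ge0 ?xconv -?kE //; first exact: ltW.
  by rewrite -mulNr mulr_ge0 // oppr_ge0 ltW.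
have A0 : 0 < A.
  have [ik'|ki] := ltnP i k; first by apply: conv; lia.
  rewrite lt0r gen; [|lia..]; rewrite /=.
  have := yconv k.+1 m (leqnn _) kltm (leqnn _).
  by rewrite det3DZ det3_rep12 mulr0 addr0 pmulr_rge0.
have B0 : 0 < B.
  by rewrite lt0r gen //=; [apply: simp|lia].
(* As [A] and [B] are positive, [p m.+1] lies between [p m] and [y]; its sign conditions reduce to
   those of these two points. *)
have qE : A *: p m.+1 = 1 *: y + B *: p m.
  have := det3_relation (p k) (p k.+1) (p m) (p m.+1).
  rewrite -/A -/B -/(F k) -/(F k.+1) /y scale1r scaleNr => E.
  by rewrite addrAC E addrAC subrr add0r.
have qdet a b : A * det3 (p a) (p b) (p m.+1)
    = det3 y (p a) (p b) + B * det3 (p a) (p b) (p m).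
  rewrite ![det3 (p a) (p b) _]det3C ![det3 (p b) _ (p a)]det3C.
  by rewrite -det3Z qE det3DZ mul1r.
exists k, y; split; last first.
  move=> z z0; have := det3DZ (p m.+1) (p m) (p m.+1) z A (- B).
  have -> : A *: p m.+1 + (- B) *: p m = y by rewrite qE scale1r scaleNr addrK.
  by move=> ->; rewrite det3_rep12 mulr0 add0r mulNr oppr_lt0 mulr_gt0.
split=> //.
- lia.
- by exists (F k.+1), (- F k); rewrite oppr_ge0 !ltW.
- move=> a b c ka ab bc; rewrite leq_eqVlt => /orP[/eqP cE|cm]; last first.
    by apply: conv => //; lia.
  have [bm|mb] := ltnP b m; last first.
    by rewrite cE (_ : b = m) ?Fpos //; lia.
  rewrite cE -(pmulr_rgt0 _ A0) qdet ltr_wpDl ?yconv //; [lia|].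
  by rewrite mulr_gt0 //; apply: conv => //; lia.
- move=> a b ka ab; rewrite leq_eqVlt => /orP[/eqP bE|bm]; last exact: yconv.
  rewrite bE -(pmulr_rge0 _ A0).
  have -> : A * det3 y (p a) (p m.+1) = B * det3 y (p a) (p m).
    rewrite ![det3 y (p a) _]det3C ![det3 (p a) _ y]det3C -det3Z qE det3DZ.
    by rewrite det3_rep12 mulr0 add0r.
  apply: mulr_ge0; first exact: ltW.
  have [am|ma] := ltnP a m; first exact: yconv.
  by rewrite (_ : a = m) ?det3_rep23 //; lia.
- move=> a ka; rewrite leq_eqVlt => /orP[/eqP ->|am]; last by apply: wpos; lia.
  rewrite -(pmulr_rgt0 _ A0).
  have -> : A * dotv w (p m.+1) = dotv w y + B * dotv w (p m).
    by rewrite -dotvZ qE dotvDZ mul1r.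
  by rewrite dotvDZ !addr_gt0 // mulr_gt0 ?oppr_gt0 // wpos //; lia.
Qed.

Definition left_turning (R : realFieldType) (n : nat) (p : nat -> 'rV[R]_3) :=
  forall i : nat, (i.+2 <= n)%N -> 0 < det3 (p i) (p i.+1) (p i.+2).

(** Iterates [trapped_step] with the same [w]; left turns supply the sign hypotheses, and the last
    trap includes [p n] itself. *)
Lemma trapped_forever (R : realFieldType) (n : nat) (p : nat -> 'rV[R]_3) w i m x :
  p n = - p 0%N -> generic_chain n p -> simple_chain n p -> left_turning n p ->
  (m < n)%N -> trapped p w i m x -> det3 x (p m) (p m.+1) < 0 ->
  0 < dotv w (p n).
Proof.
move=> pn gen simp turn mn.
move: {2}(n - m)%N (erefl (n - m)%N) => r.
elim: r i m x mn => [|r IH] i m x mn nm tr xneg; first by lia.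
have [im _ _ _ _] := tr.
have turnm : 0 < det3 (p m.-1) (p m) (p m.+1).
  by case: m im mn {nm tr xneg} => // m' _ mn; apply: turn.
have [k [y [try yneg]]] := trapped_step pn gen simp mn tr turnm xneg.
have [m1n|nm1] := ltnP m.+1 n.
  by apply: (IH _ _ _ m1n _ try); [lia|apply/yneg/turn].
have <- : m.+1 = n by lia.
by case: try => k1 _ _ _; apply; lia.
Qed.

(** * Growing convex windows *)

(* Membership in the cone spanned by p_j, ..., p_m, stated through its dual. *)
Definition in_cone (R : realFieldType) (p : nat -> 'rV[R]_3) (j m : nat) x :=
  forall w, (forall a : nat, (j <= a)%N -> (a <= m)%N -> 0 <= dotv w (p a)) ->
    0 <= dotv w x.

(** Here [p m.+1] lies beyond the closing edge. The vertices before the point of tangency lie in the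
    cone of [p k], [p m] and [p m.+1], so dropping them loses nothing of the cone. *)
Lemma window_step (R : realFieldType) (n : nat) (p : nat -> 'rV[R]_3) j m x :
  generic_chain n p -> left_turning n p -> (j.+1 < m)%N -> (m.+1 < n)%N ->
  convex_window p j m -> 0 < det3 (p j) (p m) (p m.+1) -> in_cone p j m x ->
  exists k : nat, [/\ (k < m)%N, convex_window p k m.+1 & in_cone p k m.+1 x].
Proof.
move=> gen turn jm mn conv gj conex.
pose om a b := det3 (p a) (p b) (p m.+1).
(* The sign is known at [j] by hypothesis and at [m.-1] by the left turn; the Plücker relation
   interpolates. *)
have gpos a : (j <= a)%N -> (a < m)%N -> 0 < om a m.
  move=> ja am; have [->//|aj] := eqVneq a j.
  have tm : 0 < om m.-1 m.
    by have := turn m.-1; rewrite prednK; [apply; lia|lia].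
  have [->//|am1] := eqVneq a m.-1.
  have := det3_plucker (p j) (p a) (p m.-1) (p m) (p m) (p m.+1).
  rewrite det3_rep12 mulr0 addr0 => E.
  have C : 0 < det3 (p j) (p m.-1) (p m) by apply: conv => //; lia.
  rewrite -(pmulr_rgt0 _ C) -E addr_gt0 // mulr_gt0 //; apply: conv => //; lia.
(* k is the point of tangency from p_{m+1} to the polygon p_j, ..., p_m. *)
pose P k :=
  [&& (j <= k)%N, (k < m)%N & [forall c : 'I_m, (k <= c)%N ==> (0 < om c c.+1)]].
have exP : exists k, P k.
  exists m.-1; apply/and3P; split; [lia|lia|].
  apply/forallP => c; apply/implyP => mc.
  have -> : c = m.-1 :> nat by have := ltn_ord c; lia.
  by rewrite prednK; [apply: gpos; lia|lia].
case: (ex_minnP exP) => k /and3P[jk km /forallP hk] kmin.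
have hpos c : (k <= c)%N -> (c < m)%N -> 0 < om c c.+1.
  by move=> kc cm; have /implyP := hk (Ordinal cm); apply.
have hneg : (j < k)%N -> om k.-1 k < 0.
  move=> jk'; rewrite lt_neqAle gen; [|lia..]; rewrite /=.
  rewrite leNgt; apply/negP => hk1.
  suff : P k.-1 by move/kmin; lia.
  apply/and3P; split; [lia|lia|].
  apply/forallP => c; apply/implyP => kc.
  have [kc'|ck] := leqP k c; first exact: hpos.
  by rewrite (_ : c = k.-1 :> nat) ?prednK //; lia.
(* By [gpos], the vertices before [p m] seen from [p m.+1] lie in an open half-plane, where angular
   order is transitive; so consecutive signs determine all of them. *)
have ompos a b : (k <= a)%N -> (a < b)%N -> (b <= m)%N -> 0 < om a b.
  move=> ka; elim: b => // b IH; rewrite ltnS leq_eqVlt => /orP[/eqP <- bm|ab bm].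
    by apply: hpos; lia.
  have [bE|bm'] := eqVneq b.+1 m; first by rewrite bE; apply: gpos; lia.
  have := det3_plucker (p a) (p b) (p b.+1) (p m.+1) (p m) (p m.+1).
  rewrite det3_rep13 mulr0 addr0 -!/(om _ _) => E.
  have gb : 0 < om b m by apply: gpos; lia.
  rewrite -(pmulr_lgt0 _ gb) -E addr_gt0 // mulr_gt0 //.
  + by apply: hpos; lia.
  + by apply: gpos; lia.
  + by apply: IH; lia.
  + by apply: gpos; lia.
exists k; split=> //.
  move=> a b c ka ab bc; rewrite leq_eqVlt => /orP[/eqP cE|cm].
    by rewrite cE; apply: ompos; lia.
  by apply: conv; lia.
move=> w wpos; apply: conex => a ja am.
have [ka|ak] := leqP k a; first by apply: wpos; lia.
have gk : 0 < om k m by apply: gpos; lia.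
have omak : om a k < 0.
  have [->|ak1] := eqVneq a k.-1; first by apply: hneg; lia.
  have := det3_plucker (p a) (p k.-1) (p k) (p m) (p k) (p m.+1).
  rewrite det3_rep12 mulr0 addr0 => E.
  have C : 0 < det3 (p k.-1) (p k) (p m) by apply: conv => //; lia.
  rewrite -(pmulr_rlt0 _ C) E -oppr_gt0 opprD addr_gt0 // -mulrN mulr_gt0 //.
  + by apply: conv => //; lia.
  + by rewrite oppr_gt0; apply: hneg; lia.
  + by apply: conv => //; lia.
  + by rewrite det3_swap opprK.
have := dotv_relation w (p a) (p k) (p m) (p m.+1).
rewrite -!/(om _ _) => E.
rewrite -(pmulr_rge0 _ gk).
have -> : om k m * dotv w (p a) = om a m * dotv w (p k)
    + det3 (p a) (p k) (p m) * dotv w (p m.+1) + (- om a k) * dotv w (p m).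
  by rewrite -E; ring.
have wk : 0 <= dotv w (p k) by apply: wpos; lia.
have wm : 0 <= dotv w (p m) by apply: wpos; lia.
have wm1 : 0 <= dotv w (p m.+1) by apply: wpos; lia.
have ga : 0 <= om a m by apply/ltW/gpos; lia.
have akm : 0 <= det3 (p a) (p k) (p m) by apply/ltW/conv; lia.
by rewrite !addr_ge0 ?mulr_ge0 // oppr_ge0 ltW.
Qed.

Lemma no_simple_left_turning_chain (R : realFieldType) (n : nat) (p : nat -> 'rV[R]_3) :
  (3 <= n)%N -> p n = - p 0%N -> generic_chain n p -> simple_chain n p ->
  ~ left_turning n p.
Proof.
move=> n3 pn gen simp turn.
suff main r j m : (n - m)%N = r.+1 -> (j.+1 < m)%N -> convex_window p j m ->
    ~ in_cone p j m (p 0%N).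
  apply: (main (n - 2).-1 0%N 2); [lia|by []| |].
    move=> a b c _ ab bc c2.
    have [-> -> ->] : [/\ a = 0, b = 1 & c = 2]%N by split; lia.
    by apply: turn; lia.
  by move=> w; apply.
elim: r j m => [|r IH] j m nm jm conv cone.
  (* Now [m = n - 1]: the last edge of the window is nonnegative on [p 0], while the left turn makes
     it positive on [p n]. *)
  have [w wE] := det3_dotv (p m.-1) (p m).
  have : 0 <= dotv w (p 0%N).
    apply: cone => a ja am; rewrite -wE.
    have [->|am'] := eqVneq a m; first by rewrite det3_rep23.
    have [->|am1] := eqVneq a m.-1; first by rewrite det3_rep13.
    by rewrite -det3C; apply/ltW/conv; lia.
  have := turn m.-1; rewrite prednK; last by lia.
  have -> : m.+1 = n by lia.
  by rewrite pn det3N wE oppr_gt0 => /(_ _)/lt_geF ->; [|lia].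
have [neg|pos|zero] := ltgtP (det3 (p j) (p m) (p m.+1)) 0.
(* The chain turns into the polygon, and the trap starts with [x = p j]. The three edge forms are
   nonnegative on the window and never vanish together at one of its vertices, so their sum is a
   strict witness. *)
- have [w1 w1E] := det3_dotv (p j) (p j.+1).
  have [w2 w2E] := det3_dotv (p m.-1) (p m).
  have [w3 w3E] := det3_dotv (p m) (p j).
  have wpos a : (j <= a)%N -> (a <= m)%N -> 0 < dotv (w1 + w2 + w3) (p a).
    move=> ja am; rewrite !dotvDl -w1E -w2E -w3E.
    have [->|aj] := eqVneq a j.
      by rewrite det3_rep13 det3_rep23 add0r addr0 -det3C; apply: conv; lia.
    have [->|am'] := eqVneq a m.
      by rewrite det3_rep23 det3_rep13 !addr0; apply: conv; lia.
    apply: ltr_wpDl; last by rewrite det3C; apply: conv; lia.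
    apply: addr_ge0.
      have [->|aj1] := eqVneq a j.+1; first by rewrite det3_rep23.
      by apply/ltW/conv; lia.
    have [->|am1] := eqVneq a m.-1; first by rewrite det3_rep13.
    by rewrite -det3C; apply/ltW/conv; lia.
  have : 0 < dotv (w1 + w2 + w3) (p n).
    apply: (trapped_forever pn gen simp turn _ _ neg (i := j)); first by lia.
    split=> //.
    + by exists 1, 0; rewrite scale1r scale0r addr0.
    + by move=> a b c ja; apply: conv; lia.
    + by move=> a b ja ab bm; apply/ltW/conv.
  rewrite pn dotvN oppr_gt0 ltNge cone // => a ja am; exact/ltW/wpos.
- have [|k [km convk conek]] := window_step gen turn jm _ conv pos cone; first by lia.
  by apply: (IH k m.+1) => //; lia.
- by suff /eqP : det3 (p j) (p m) (p m.+1) != 0 by []; apply: gen; lia.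
Qed.

(** * Crossings and inflections with cyclic indices *)

Lemma modnSm (i m : nat) : ((i %% m).+1 = i.+1 %[mod m])%N.
Proof. by rewrite -addn1 modnDml addn1. Qed.

Lemma vtx_mod (R : realType) (u : nat -> 'rV[R]_3) m i : vtx u m (i %% m) = vtx u m i.
Proof. by rewrite /vtx modn_mod. Qed.

Lemma vtx_modS (R : realType) (u : nat -> 'rV[R]_3) m i :
  vtx u m (i %% m).+1 = vtx u m i.+1.
Proof. by rewrite /vtx modnSm. Qed.

Lemma edges_meet_mod (R : realType) (u : nat -> 'rV[R]_3) m i j :
  edges_meet u m (i %% m) (j %% m) <-> edges_meet u m i j.
Proof. by rewrite /edges_meet !vtx_mod !vtx_modS. Qed.

Lemma edges_meet_sym (R : realType) (u : nat -> 'rV[R]_3) m i j :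
  edges_meet u m i j -> edges_meet u m j i.
Proof. by case=> x [? ?]; exists x. Qed.

Lemma adjacent_mod m i j : adjacent m (i %% m) (j %% m) = adjacent m i j.
Proof. by rewrite /adjacent !modn_mod !modnSm. Qed.

Lemma adjacent_sym m i j : adjacent m i j = adjacent m j i.
Proof. by rewrite /adjacent orbC. Qed.

Lemma adjacentDr m i j n : adjacent m (i + n) (j + n) = adjacent m i j.
Proof. by rewrite /adjacent -!addSn !eqn_modDr. Qed.

(** Normalising [x] to unit length puts it on both arcs. *)
Lemma edges_meet_cone (R : realType) (u : nat -> 'rV[R]_3) m i j x s t s' t' :
  0 <= s -> 0 <= t -> 0 <= s' -> 0 <= t' -> x != 0 ->
  x = s *: vtx u m i + t *: vtx u m i.+1 ->
  x = s' *: vtx u m j + t' *: vtx u m j.+1 -> edges_meet u m i j.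
Proof.
move=> s0 t0 s'0 t'0 xn0 xi xj.
pose N2 := \sum_(l < 3) x 0 l ^+ 2.
have N2_gt0 : 0 < N2.
  rewrite lt0r sumr_ge0 ?andbT; last by move=> l _; rewrite sqr_ge0.
  apply: contraNneq xn0 => /eqP; rewrite psumr_eq0; last first.
    by move=> l _; rewrite sqr_ge0.
  by move=> /allP x0; apply/eqP/rowP => l; have := x0 l; rewrite mem_index_enum
     sqrf_eq0 mxE => /(_ isT)/eqP.
pose r := (Num.sqrt N2)^-1.
have r0 : 0 <= r by rewrite invr_ge0 sqrtr_ge0.
have sph : on_sphere (r *: x).
  rewrite /on_sphere; under eq_bigr do rewrite mxE exprMn.
  by rewrite -big_distrr /= -/N2 exprVn sqr_sqrtr ?mulVf ?gt_eqF ?ltW.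
exists (r *: x); split; split=> //.
- by exists (r * s), (r * t); rewrite !mulr_ge0 // xi scalerDr !scalerA.
- by exists (r * s'), (r * t'); rewrite !mulr_ge0 // {1}xj scalerDr !scalerA.
Qed.

Lemma self_intersections_gt0 (R : realType) (u : nat -> 'rV[R]_3) m i j :
  (0 < m)%N -> (i != j %[mod m])%N -> ~~ adjacent m i j -> edges_meet u m i j ->
  (0 < num_self_intersections u m)%N.
Proof.
move=> m0; wlog ij : i j / (i %% m < j %% m)%N.
  move=> wl nij nadj meet; have [lt|gt|eq] := ltngtP (i %% m) (j %% m).
  - exact: wl nadj meet.
  - by apply: (wl j i) => //; rewrite 1?eq_sym 1?adjacent_sym //; apply: edges_meet_sym.
  - by rewrite eq eqxx in nij.
move=> _ nadj meet; rewrite card_gt0; apply/set0Pn.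
exists (Ordinal (ltn_pmod i m0), Ordinal (ltn_pmod j m0)).
rewrite inE /= ij adjacent_mod nadj /=; apply/asboolP; exact/edges_meet_mod.
Qed.

Lemma on_arcN (R : realType) (a b x : 'rV[R]_3) :
  on_arc a b x -> on_arc (- a) (- b) (- x).
Proof.
case=> sph [s [t [s0 [t0 xE]]]]; split.
  by rewrite /on_sphere -[RHS]sph; apply: eq_bigr => l _; rewrite mxE sqrrN.
by exists s, t; rewrite xE opprD !scalerN.
Qed.

(** A common point would lie in the cone of [a] and [b] and in its negative; by independence all
    coefficients vanish, contrary to unit length. *)
Lemma antipodal_arcs_disjoint (R : realType) (a b c x : 'rV[R]_3) :
  det3 a b c != 0 -> on_arc a b x -> ~ on_arc (- a) (- b) x.
Proof.
move=> nz [sph [s [t [s0 [t0 xE]]]]] [_ [s' [t' [s'0 [t'0 xE']]]]].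
have rel : (s + s') *: a + (t + t') *: b = 0.
  rewrite !scalerDl addrACA -xE -[_ + t' *: b]opprK opprD -!scalerN -xE'.
  by rewrite subrr.
have sE : s + s' = 0.
  have := det3DZ a b b c (s + s') (t + t'); rewrite rel det3_rep12 mulr0 addr0.
  rewrite -(scale0r 0) det3Z mul0r => /esym/eqP.
  by rewrite mulf_eq0 (negPf nz) orbF => /eqP.
have tE : t + t' = 0.
  have := det3DZ a b c a (s + s') (t + t'); rewrite rel det3_rep13 mulr0 add0r.
  rewrite -(scale0r 0) det3Z mul0r -det3C => /esym/eqP.
  by rewrite mulf_eq0 (negPf nz) orbF => /eqP.
have s00 : s = 0 by apply/eqP; rewrite eq_le s0 andbT; lra.
have t00 : t = 0 by apply/eqP; rewrite eq_le t0 andbT; lra.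
move: sph; rewrite xE s00 t00 !scale0r addr0 /on_sphere big1 => [/esym/eqP|l _].
  by rewrite oner_eq0.
by rewrite mxE expr0n.
Qed.

Lemma symmetric_self_intersections_ge2 (R : realType) (n : nat) (u : nat -> 'rV[R]_3) :
  (forall i, vtx u (2 * n) (i + n) = - vtx u (2 * n) i) ->
  (forall i, det3 (vtx u (2 * n) i) (vtx u (2 * n) i.+1) (vtx u (2 * n) i.+2) != 0) ->
  (0 < num_self_intersections u (2 * n))%N ->
  (2 <= num_self_intersections u (2 * n))%N.
Proof.
move=> sym nz; rewrite card_gt0 => /set0Pn[[i j]].
rewrite /num_self_intersections; set S := [set _ | _]; move=> ijS.
move: (ijS); rewrite inE /= => /and3P[ij nadj /asboolP meet].
have meetn : edges_meet u (2 * n) (i + n) (j + n).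
  case: meet => x [xi xj]; exists (- x).
  by rewrite -!addSn !sym; split; apply: on_arcN.
have jin : j != (i + n)%N :> nat.
  apply/eqP => jE; case: meet => x []; rewrite jE -addSn !sym.
  exact: antipodal_arcs_disjoint (nz i).
have lti := ltn_ord i; have ltj := ltn_ord j.
have suff_pair (k l : nat) : (k < l)%N -> (l < 2 * n)%N -> k != i :> nat ->
    ~~ adjacent (2 * n) k l -> edges_meet u (2 * n) k l -> (2 <= #|S|)%N.
  move=> kl ln ki nadjk meetk; have kn := ltn_trans kl ln.
  rewrite (cardsD1 (i, j)) ijS (cardsD1 (Ordinal kn, Ordinal ln)) !inE /=.
  rewrite kl nadjk xpair_eqE /= -val_eqE (negPf ki) /=.
  by move/asboolP: meetk => ->.
have nadjn : ~~ adjacent (2 * n) (i + n) (j + n) by rewrite adjacentDr.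
have [jn|nj] := ltnP j n.
  by apply: (suff_pair (i + n) (j + n))%N => //; lia.
have jE : ((j + n) %% (2 * n) = j - n)%N.
  have -> : (j + n = j - n + 2 * n)%N by lia.
  by rewrite modnDr modn_small //; lia.
(* If [i < n <= j], reduction modulo [2 * n] reverses the pair. Only here could the antipodal
   crossing be the original one, which [jin] excludes. *)
have [iltn|ni] := ltnP i n.
  have iE : ((i + n) %% (2 * n) = i + n)%N by rewrite modn_small //; lia.
  apply: (suff_pair (j - n) (i + n))%N; try lia.
    by rewrite -jE -iE adjacent_mod adjacent_sym.
  by rewrite -jE -iE; apply/edges_meet_mod/edges_meet_sym.
have iE : ((i + n) %% (2 * n) = i - n)%N.
  have -> : (i + n = i - n + 2 * n)%N by lia.
  by rewrite modnDr modn_small //; lia.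
apply: (suff_pair (i - n) (j - n))%N; try lia.
  by rewrite -jE -iE adjacent_mod.
by rewrite -jE -iE; apply/edges_meet_mod.
Qed.

Lemma inflections_ge_size (R : realType) (u : nat -> 'rV[R]_3) m k (s : seq nat) :
  (0 < m)%N -> uniq s -> (forall x, x \in s -> (x < m)%N) ->
  (forall x, x \in s ->
     det3 (vtx u m (k + x)) (vtx u m (k + x).+1) (vtx u m (k + x).+2)
     * det3 (vtx u m (k + x).+1) (vtx u m (k + x).+2) (vtx u m (k + x).+3) < 0) ->
  (size s <= num_inflections u m)%N.
Proof.
move=> m0 us ltm infl; rewrite /num_inflections cardE.
(* A sign change between the turns starting at [k + x] and [k + x + 1] belongs to the edge with
   index [k + x + 1]. *)
pose f x := Ordinal (ltn_pmod (k + x).+1 m0).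
rewrite -(size_map f); apply: uniq_leq_size.
  rewrite map_inj_in_uniq // => x y xs ys /(congr1 val)/eqP /=.
  rewrite -(addn1 (k + x)) -(addn1 (k + y)) eqn_modDr eqn_modDl.
  by rewrite !modn_small ?ltm // => /eqP.
move=> _ /mapP[x xs ->]; rewrite mem_enum inE /= vtx_mod !vtx_modS.
have -> : vtx u m ((k + x).+1 %% m + m).-1 = vtx u m (k + x).
  rewrite /vtx; congr u; apply/eqP.
  rewrite -(eqn_modDr 1) !addn1 prednK ?addn_gt0 ?m0 ?orbT //.
  by rewrite modnDr modn_mod.
have -> : vtx u m ((k + x).+1 %% m).+2 = vtx u m (k + x).+3.
  by rewrite /vtx; congr u; rewrite -addn2 modnDml addn2.
exact: infl.
Qed.

(** * From the polygon to a chain, and the final count *)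

Lemma sign_change (R : realFieldType) (f : nat -> R) a b :
  (a <= b)%N -> (forall i, f i != 0) -> f a < 0 -> 0 < f b ->
  exists c, [/\ (a <= c)%N, (c < b)%N, f c < 0 & 0 < f c.+1].
Proof.
move=> ab nz fa; elim: b ab => [|b IH] ab fb.
  by move: ab fa; rewrite leqn0 => /eqP -> /(lt_trans fb); rewrite ltxx.
have aEb : a != b.+1 by apply: contraTneq fa => ->; rewrite -leNgt ltW.
have [fb'|fb'|fb0] := ltgtP (f b) 0.
- by exists b; split=> //; lia.
- by have [|c [ac cb fc fc1]] := IH _ fb'; [lia|exists c; split=> //; lia].
- by have := nz b; rewrite fb0 eqxx.
Qed.

(** If the conclusion failed, moving the negative terms of [det3_relation] across would exhibit a
    common point of the two edges. *)
Lemma simple_chain_of_polygon (R : realType) (u : nat -> 'rV[R]_3) n q :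
  num_self_intersections u (2 * n) = 0%N ->
  simple_chain n (fun i => vtx u (2 * n) (q + i)).
Proof.
move=> D0 i j ij jn Fi Fi1 A0; rewrite leNgt; apply/negP => B0.
suff : (0 < num_self_intersections u (2 * n))%N by rewrite D0.
move: Fi Fi1 A0 B0; rewrite !addnS.
set a := vtx _ _ (q + i); set b := vtx _ _ (q + i).+1.
set c := vtx _ _ (q + j); set d := vtx _ _ (q + j).+1 => Fi Fi1 A0 B0.
have rel := det3_relation a b c d.
apply: (self_intersections_gt0 (i := q + i) (j := q + j)); first by lia.
- by rewrite eqn_modDl !modn_small; lia.
- by rewrite /adjacent -(addnS q i) -(addnS q j) !eqn_modDl !modn_small; lia.
apply: (edges_meet_cone (x := det3 b c d *: a + (- det3 a c d) *: b)
  (ltW Fi1) _ _ (ltW A0) _ erefl (s' := - det3 a b d)); rewrite ?oppr_ge0 ?ltW //.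
  (* The point is nonzero because [det3 _ b c] takes the value [det3 b c d * det3 a b c] on it. *)
  apply/eqP => y0.
  have := det3DZ a b b c (det3 b c d) (- det3 a c d).
  rewrite y0 -(scale0r 0) det3Z mul0r det3_rep12 mulr0 addr0.
  by apply/eqP; rewrite eq_sym mulf_neq0 // gt_eqF.
have -> : det3 b c d *: a = det3 a b c *: d + det3 a c d *: b - det3 a b d *: c.
  by rewrite [det3 a b c *: d + _]addrC -rel addrK.
by rewrite !scaleNr addrAC addrK addrC.
Qed.

Theorem theorem14 (R : realType) (n : nat) (u : nat -> 'rV[R]_3) :
  (3 <= n)%N ->
  (forall i : nat, on_sphere (vtx u (2 * n) i)) ->
  (forall i : nat, vtx u (2 * n) (i + n) = - vtx u (2 * n) i) ->
  (forall i j k : nat,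
      (i %% n != j %% n)%N -> (j %% n != k %% n)%N -> (i %% n != k %% n)%N ->
      det3 (vtx u (2 * n) i) (vtx u (2 * n) j) (vtx u (2 * n) k) != 0) ->
  (6 <= 2 * num_self_intersections u (2 * n) + num_inflections u (2 * n))%N.
Proof.
move=> n3 _ sym nz.
have m0 : (0 < 2 * n)%N by lia.
(* Note the shift: [f i] is the turn at vertex [i + 1]. *)
pose f i := det3 (vtx u (2 * n) i) (vtx u (2 * n) i.+1) (vtx u (2 * n) i.+2).
have gen q : generic_chain n (fun i => vtx u (2 * n) (q + i)).
  move=> a b c ab bc cn acn; apply: nz; rewrite eqn_modDl.
  - by rewrite !modn_small; lia.
  - have [->|cn'] := eqVneq c n; last by rewrite !modn_small; lia.
    by rewrite modnn modn_small; lia.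
  - have [cE|cn'] := eqVneq c n; last by rewrite !modn_small; lia.
    by rewrite cE modnn modn_small; lia.
have fN i : f (i + n)%N = - f i.
  by rewrite /f -!addSn !sym !det3E !mxE; ring.
have f0 i : f i != 0.
  by have := gen i 0 1 2; rewrite addn0 addn1 addn2; apply; lia.
have [k [fk fk1]] : exists k, f k < 0 /\ 0 < f k.+1.
  have [fneg|fpos|fE] := ltgtP (f 0) 0.
  - have [|c [_ _ fc fc1]] := sign_change (leq0n n) f0 fneg; last by exists c.
    by rewrite -[n]add0n fN oppr_gt0.
  - have [||c [_ _ fc fc1]] := sign_change (leq_addr n n) f0; last by exists c.
      by rewrite -[n]add0n fN oppr_lt0.
    by rewrite fN -[n]add0n fN opprK.
  - by have := f0 0%N; rewrite fE eqxx.
have change_n i : f i * f i.+1 < 0 -> f (i + n)%N * f (i + n).+1 < 0.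
  by rewrite -addSn !fN mulrNN.
have change_k : f k * f k.+1 < 0 by rewrite nmulr_rlt0.
have I2 : (2 <= num_inflections u (2 * n))%N.
  apply: (@inflections_ge_size _ u (2 * n) k [:: 0; n]%N) => //.
  - by rewrite /= inE andbT eq_sym -lt0n; lia.
  - by move=> x; rewrite !inE => /orP[]/eqP ->; lia.
  - by move=> x; rewrite !inE => /orP[]/eqP ->; [rewrite addn0|apply: change_n].
(* One crossing forces two by symmetry, and 2 * 2 + 2 = 6. *)
have [D0|Dn0] := posnP (num_self_intersections u (2 * n)); last first.
  by have := symmetric_self_intersections_ge2 sym f0 Dn0; lia.
suff : (6 <= num_inflections u (2 * n))%N by lia.
(* The half-polygon from vertex [k + 1] to its antipode cannot turn left throughout. *)
have [s sn fs] : exists2 s : nat, (s < n)%N & f (k.+1 + s)%N < 0.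
  apply: contrapT => nos.
  apply: (@no_simple_left_turning_chain _ n (fun i => vtx u (2 * n) (k.+1 + i))) => //.
  - by rewrite sym addn0.
  - exact: simple_chain_of_polygon.
  - move=> i i_n; have [fi|fi|fi] := ltgtP (f (k.+1 + i)%N) 0.
    + by case: nos; exists i => //; lia.
    + by rewrite !addnS.
    + by have := f0 (k.+1 + i)%N; rewrite fi eqxx.
(* The signs of [f] at [k], [k + 1], [k + 1 + s], [k + n] are -, +, -, +. This gives sign changes at
   offsets 0 < [a - k] < [b - k] < [n] from [k], and shifting by [n] doubles them. *)
have nf0 i : - f i != 0 by rewrite oppr_eq0.
have [||a [ka as' fa fa1]] := sign_change (leq_addr s k.+1) nf0.
- by rewrite oppr_lt0.
- by rewrite oppr_gt0.
have [||b [sb bn fb fb1]] := sign_change (_ : (k.+1 + s <= k + n)%N) f0 fs.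
- lia.
- by rewrite fN oppr_gt0.
have change_a : f a * f a.+1 < 0 by rewrite pmulr_rlt0 -?oppr_gt0 // -oppr_lt0.
have change_b : f b * f b.+1 < 0 by rewrite nmulr_rlt0.
apply: (@inflections_ge_size _ u (2 * n) k
  [:: 0; a - k; b - k; n; a - k + n; b - k + n]%N) => //.
- by rewrite /= !inE; lia.
- by move=> x; rewrite !inE; lia.
- have ak : (k + (a - k) = a)%N by lia.
  have bk : (k + (b - k) = b)%N by lia.
  move=> x; rewrite !inE => /or4P[/eqP ->|/eqP ->|/eqP ->|/or3P[]/eqP ->];
    rewrite ?addn0 ?addnA ?ak ?bk //; exact: change_n.
Qed.
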